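(* Let $X$ be a finite quandle and $K$ an oriented knot. The relation $\sim$ is an equivalence relation on the set of colorings of $K$ by $X$.
   Context: Quandle: a set $X$ with a binary operation $\triangleright$ such that (i) $a\triangleright a=a$ for all $a$; (ii) for all $a,b$ there is a unique $x$ with $a=x\triangleright b$, and this $x$ is denoted $a\triangleright^{-1}b$; (iii) $(a\triangleright b)\triangleright c=(a\triangleright c)\triangleright(b\triangleright c)$ for all $a,b,c$. Diagrams: diagrams of the oriented knot $K$ are oriented knot diagrams in the plane, identified up to planar isotopy (planar isotopies carry colorings along). $R_D$ is the finite set of arcs of $D$. Coloring: a coloring of $D$ is a map $\mathcal C:R_D\to X$ such that at each crossing with over-arc $r$ and under-arcs $r_1,r_2$, where $r_2$ lies to the left of the oriented over-arc $r$ and $r_1$ to its right, $\mathcal C(r_2)=\mathcal C(r_1)\triangleright\mathcal C(r)$ (equivalently $\mathcal C(r_1)=\mathcal C(r_2)\triangleright^{-1}\mathcal C(r)$). The orientation of the under-arcs plays no role. The set of colorings of $K$ is the set of all colorings of all diagrams of $K$. Relation $\sim$: for colorings $\mathcal C$ of $D$ and $\mathcal C'$ of $D'$ ($D,D'$ diagrams of $K$), $\mathcal C\sim\mathcal C'$ if there is a finite (possibly empty) sequence of steps of the following kind taking $\mathcal C$ to $\mathcal C'$. Each step is an oriented Reidemeister move or its inverse performed inside a disk, with all portions of arcs outside the disk keeping their colors, and with the following rule inside the disk. Type I: a single strand $r$ is replaced by a strand with a kink, with arcs $r'_1,r'_2$, and $\mathcal C(r)=\mathcal C'(r'_1)=\mathcal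 C'(r'_2)$. Type II: two disjoint strands $r,s$ with $\mathcal C(r)=x$, $\mathcal C(s)=y$ are replaced by an over-strand $s'$ passing over a strand that is broken into consecutive arcs $r'_1,r'_2,r'_3$, with $\mathcal C'(s')=y$, $\mathcal C'(r'_1)=\mathcal C'(r'_3)=x$ and $\mathcal C'(r'_2)=x\triangleright^{\pm1}y$, the sign being forced by the coloring condition. Type III: the arcs that meet the boundary of the disk keep their colors, and the one short arc contained in the disk (the middle piece of the bottom strand) receives the color forced by the coloring condition. *)

(* Defs.v *)
From mathcomp Require Import all_boot all_order all_algebra.
From mathcomp Require Import all_classical all_reals all_analysis.

Set Implicit Arguments.
Unset Strict Implicit.
Unset Printing Implicit Defensive.

Import Order.TTheory GRing.Theory Num.Theory.
Import numFieldNormedType.Exports.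
Local Open Scope classical_set_scope.
Local Open Scope ring_scope.

(* Knots and diagrams are treated in the tame topological category.  A closed
   oriented curve is a 1-periodic map on [R], oriented by increasing
   parameter; "isotopy" always means ambient isotopy. *)

Record finQuandle := FinQuandle {
  quandle_sort :> finType;
  qop : quandle_sort -> quandle_sort -> quandle_sort;
  qop_idem : forall a, qop a a = a;
  qop_solve : forall a b, exists! x, a = qop x b;
  qop_distr : forall a b c, qop (qop a b) c = qop (qop a c) (qop b c)
}.

Notation "a ▷ b" := (qop a b) (at level 45, left associativity).

(* [odflt]'s default is never reached, by [qop_solve]. *)
Definition qopV (X : finQuandle) (a b : X) : X :=
  odflt a [pick x | a == x ▷ b].

Notation "a ▷⁻¹ b" := (qopV a b) (at level 45, left associativity).

Section AmbientIsotopy.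
Variables (R : realType) (T : topologicalType).

(* The maps [(u, x) |-> (u, H u x)] and [(u, x) |-> (u, G u x)] are mutually
   inverse level-preserving homeomorphisms of [0, 1] * T. *)
Definition ambient_isotopy (H : R -> T -> T) : Prop :=
  (forall x, H 0 x = x) /\
  exists G : R -> T -> T,
    [/\ {within `[0, 1] `*` setT, continuous (fun p : R * T => H p.1 p.2)},
        {within `[0, 1] `*` setT, continuous (fun p : R * T => G p.1 p.2)}
      & forall u, 0 <= u <= 1 -> cancel (H u) (G u) /\ cancel (G u) (H u)].

Definition isotopic_to_id (h : T -> T) : Prop :=
  exists2 H, ambient_isotopy H & H 1 = h.

End AmbientIsotopy.

Section KnotsAndDiagrams.
Variable R : realType.

Definition plane : Type := (R^o * R^o)%type.
Definition space : Type := (plane * R^o)%type.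

Definition same_param (s t : R) : Prop := exists m : int, t = s + m%:~R.

(* Lifts to [R] of the orientation-preserving homeomorphisms of the circle. *)
Definition reparam (r : R -> R) : Prop :=
  [/\ continuous r, {homo r : s t / s < t} & forall t, r (t + 1) = r t + 1].

Definition knot_isotopic (k k' : R -> space) : Prop :=
  exists h r, [/\ isotopic_to_id R h, reparam r
                & forall t, k' t = h (k (r t))].

Definition polygonal (k : R -> space) : Prop :=
  exists2 n : nat, (0 < n)%N & forall (i : nat) (u : R), 0 <= u <= 1 ->
    k ((i%:R + u) / n%:R) =
      (1 - u) *: k (i%:R / n%:R) + u *: k (i.+1%:R / n%:R).

Record knot := Knot {
  knot_map :> R -> space;
  knot_continuous : continuous knot_map;
  knot_periodic : forall t, knot_map (t + 1) = knot_map t;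
  knot_embedded : forall s t, knot_map s = knot_map t -> same_param s t;
  knot_tame : exists2 p, polygonal p & knot_isotopic p knot_map
}.

Definition double_pt (g : R -> plane) (s t : R) : Prop :=
  g s = g t /\ ~ same_param s t.

(* Straightened by an orientation-preserving homeomorphism of the plane, the
   strand through [s] runs along the first axis in the positive direction and
   the strand through [t] along the second axis, in the direction given by
   the sign [e].  Hence the points [g (t + e * u)], with u > 0 small, lie to
   the left of the strand through [s]. *)
Definition crossing_chart (g : R -> plane) (s t e : R) : Prop :=
  (e = 1 \/ e = -1) /\
  exists2 h : plane -> plane, isotopic_to_id R h &
    \forall u \near (0 : R),
      h (g (s + u)) = (u, 0) /\ h (g (t + u)) = (0, e * u).

(* [under] is the set of parameters at which the curve passes under another
   strand; this is the over/under information. *)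
Record diagram := Diagram {
  curve :> R -> plane;
  under : set R;
  curve_continuous : continuous curve;
  curve_periodic : forall t, curve (t + 1) = curve t;
  curve_no_triple : forall s t u, double_pt curve s t -> double_pt curve t u ->
    same_param s u;
  curve_finite :
    finite_set [set t | 0 <= t < 1 /\ exists s, double_pt curve s t];
  under_double : forall t, under t -> exists s, double_pt curve s t;
  under_over : forall s t, double_pt curve s t -> (under s <-> ~ under t);
  curve_transverse : forall s t, double_pt curve s t -> under t ->
    exists e, crossing_chart curve s t e
}.

Definition passes_over (D : diagram) (s t : R) : Prop :=
  double_pt D s t /\ under D t.

(* [D] is the vertical projection of a knot isotopic to [K], with the
   over/under information read off from the height [z]. *)
Definition diagram_of (K : knot) (D : diagram) : Prop :=
  exists z : R -> R,
    [/\ continuous z, forall t, z (t + 1) = z t,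
        forall s t, passes_over D s t -> z t < z s
      & knot_isotopic K (fun t => (D t, z t))].

(* The arcs are the subsets of the plane obtained by cutting the curve at the
   undercrossings (endpoints removed). *)
Definition arc_through (D : diagram) (t : R) : set plane :=
  D @` connected_component (~` under D) t.

Definition is_arc (D : diagram) (A : set plane) : Prop :=
  exists2 t, ~ under D t & A = arc_through D t.

Definition arc (D : diagram) : Type := {A : set plane | is_arc D A}.

(* There is a crossing with over-arc [r] and under-arcs [r1], [r2], where [r2]
   lies to the left of the oriented arc [r] and [r1] to its right. *)
Definition crossing_arcs (D : diagram) (r r1 r2 : arc D) : Prop :=
  exists s t e,
    [/\ passes_over D s t, crossing_chart D s t e,
        sval r = arc_through D s
      & \forall u \near 0^'+, sval r1 = arc_through D (t - e * u) /\
                              sval r2 = arc_through D (t + e * u)].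

Variable X : finQuandle.

Definition is_coloring (D : diagram) (C : arc D -> X) : Prop :=
  forall r r1 r2 : arc D, crossing_arcs r r1 r2 -> C r2 = C r1 ▷ C r.

Record colored_diagram := ColoredDiagram {
  diag :> diagram;
  coloring : arc diag -> X;
  coloringP : is_coloring coloring
}.

(* The arc through parameter [t] has color [x]; no color is attached to the
   parameters in [under c]. *)
Definition color_at (c : colored_diagram) (t : R) (x : X) : Prop :=
  exists2 r : arc c, sval r = arc_through c t & coloring r = x.

(* Equality of colored diagrams up to planar isotopy. *)
Definition planar_isotopic (c c' : colored_diagram) : Prop :=
  exists h r,
    [/\ isotopic_to_id R h, reparam r,
        forall t, c' t = h (c (r t)),
        forall t, under c' t <-> under c (r t)
      & forall t x, color_at c' t x <-> color_at c (r t) x].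

Definition is_disk (B : set plane) : Prop :=
  exists2 h : plane -> plane, isotopic_to_id R h &
    B = h @` [set p | p.1 ^+ 2 + p.2 ^+ 2 <= 1].

(* The part of [D] in the disk [B] consists of pairwise distinct strands
   indexed by [I], the strand [i] being parametrized by [a i, b i] and meeting
   the boundary of [B] exactly at its two endpoints. *)
Definition strands_in (I : Type) (B : set plane) (a b : I -> R) (D : diagram) :
    Prop :=
  [/\ forall i, a i < b i,
      forall t, B (D t) <-> exists i (m : int), a i <= t + m%:~R <= b i,
      forall t, B° (D t) <-> exists i (m : int), a i < t + m%:~R < b i,
      forall i j (m : int) t, a i <= t <= b i -> a j <= t + m%:~R <= b j ->
        i = j /\ m = 0
    & forall s t, double_pt D s t -> B (D s) -> B° (D s)].

(* The crossings inside the disk, as pairs (over-parameter, under-parameter)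
   of points of the strands. *)
Definition disk_crossings (I : Type) (a b : I -> R) (D : diagram) :
    set (R * R) :=
  [set st | [/\ exists i, a i <= st.1 <= b i, exists j, a j <= st.2 <= b j
              & passes_over D st.1 st.2]].

(* [c] and [c'] are parametrized so that they agree, with their colors,
   outside the interior of the disk [B].  Since this includes the endpoints of
   the strands, arcs that meet the boundary of [B] keep their colors. *)
Definition change_in_disk (I : Type) (B : set plane) (a b : I -> R)
    (c c' : colored_diagram) : Prop :=
  [/\ is_disk B, strands_in B a b c, strands_in B a b c'
    & forall t, ~ B° (c t) ->
        [/\ c' t = c t, under c' t <-> under c t
          & forall x, color_at c' t x <-> color_at c t x]].

(* The two orders of [s] and [t] and the two signs of the crossing give the
   four kinks. *)
Definition reidemeister1 (c c' : colored_diagram) : Prop :=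
  exists B (a b : unit -> R) (s t : R) (x : X),
    [/\ change_in_disk B a b c c',
        disk_crossings a b c = set0,
        disk_crossings a b c' = [set (s, t)],
        forall u, a tt <= u <= b tt -> color_at c u x
      & forall u, a tt <= u <= b tt -> ~ under c' u -> color_at c' u x].

(* Strand [true] is the over-strand, strand [false] the broken one, with
   undercrossings t1 < t2.  Two simple strands of a disk crossing exactly twice
   bound a bigon, so these conditions determine the picture. *)
Definition reidemeister2 (c c' : colored_diagram) : Prop :=
  exists B (a b : bool -> R) (s1 t1 s2 t2 : R) (x y z : X),
    [/\ change_in_disk B a b c c',
        disk_crossings a b c = set0,
        disk_crossings a b c' = [set (s1, t1); (s2, t2)],
        [/\ a true < s1 < b true, a true < s2 < b true
          & [/\ a false < t1, t1 < t2 & t2 < b false]]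
      & [/\ forall u, a false <= u <= b false -> color_at c u x,
            forall u, a true <= u <= b true ->
              color_at c u y /\ color_at c' u y,
            forall u, a false <= u < t1 \/ t2 < u <= b false ->
              color_at c' u x,
            forall u, t1 < u < t2 -> color_at c' u z
          & z = x ▷ y \/ z = x ▷⁻¹ y]].

Inductive level := Top | Middle | Bottom.

(* Three strands crossing pairwise once, [i] over [j] if [i] is above [j];
   [p i j] is the parameter, on the strand [i], of its crossing with [j]. *)
Definition triangle (a b : level -> R) (p : level -> level -> R)
    (D : diagram) : Prop :=
  (forall i j, i <> j -> a i < p i j < b i) /\
  disk_crossings a b D =
    [set (p Top Middle, p Middle Top); (p Top Bottom, p Bottom Top);
         (p Middle Bottom, p Bottom Middle)].

(* Three such strands with prescribed endpoints form one of two triangles,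
   distinguished by the order in which each strand meets the two others.  The
   colors need no further condition: the only arc of the disk that does not
   meet its boundary is the middle piece of the bottom strand, whose color is
   forced by the coloring condition. *)
Definition reidemeister3 (c c' : colored_diagram) : Prop :=
  exists B (a b : level -> R) (p p' : level -> level -> R),
    [/\ change_in_disk B a b c c', triangle a b p c, triangle a b p' c'
      & forall i j k, i <> j -> j <> k -> i <> k ->
          (p i j < p i k <-> p' i k < p' i j)].

Definition reidemeister (c c' : colored_diagram) : Prop :=
  [\/ reidemeister1 c c', reidemeister2 c c' | reidemeister3 c c'].

(* A finite, possibly empty, sequence of moves and inverse moves; diagrams are
   only considered up to planar isotopy. *)
Inductive color_equiv : colored_diagram -> colored_diagram -> Prop :=
| color_equiv_nil c c' : planar_isotopic c c' -> color_equiv c c'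
| color_equiv_cons c c1 c2 c' :
    planar_isotopic c c1 -> reidemeister c1 c2 \/ reidemeister c2 c1 ->
    color_equiv c2 c' -> color_equiv c c'.

Definition coloring_of (K : knot) : Type :=
  {c : colored_diagram | diagram_of K c}.

Definition coloring_equiv (K : knot) (C C' : coloring_of K) : Prop :=
  color_equiv (sval C) (sval C').

End KnotsAndDiagrams.

(* Main.v *)
Require Import Defs.
From mathcomp Require Import all_boot all_order all_algebra.
From mathcomp Require Import all_classical all_reals all_analysis.

(** The relation is generated by the moves, their inverses and planar isotopy,
    so that it is an equivalence relation as soon as planar isotopy is one:
    sequences of moves can be concatenated, the two isotopies at the junction
    being composed into one, and read backwards, since each step is a move or
    the inverse of one.

    For planar isotopy, the identity map, the composites and the inverses have
    to be found among the maps isotopic to the identity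
    ([isotopic_to_id_id], [isotopic_to_id_comp], [isotopic_to_id_inv]) and
    among the lifts of circle homeomorphisms ([reparam_id], [reparam_comp],
    [reparam_inv]).  Isotopies are composed and inverted level by level.  A
    lift moves every point by the same amount as its translates by integers,
    hence is unbounded in both directions; by the intermediate value theorem it
    is onto, and the inverse of a strictly increasing continuous bijection is
    continuous. *)

Set Implicit Arguments.
Unset Strict Implicit.
Unset Printing Implicit Defensive.

Import Order.TTheory GRing.Theory Num.Theory.
Import numFieldNormedType.Exports.
Local Open Scope classical_set_scope.
Local Open Scope ring_scope.

(** * Maps isotopic to the identity *)

Section IsotopicToIdentity.
Variables (R : realType) (T : topologicalType).
Implicit Types H G : R -> T -> T.

(** The map [(u, x) |-> (u, H u x)] preserves the domain [[0, 1] * T] and is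
    continuous on it, so it can be followed by any map continuous there. *)
Lemma isotopy_comp_continuous H G :
  {within `[0, 1] `*` setT, continuous (fun p : R * T => H p.1 p.2)} ->
  {within `[0, 1] `*` setT, continuous (fun p : R * T => G p.1 p.2)} ->
  {within `[0, 1] `*` setT, continuous (fun p : R * T => G p.1 (H p.1 p.2))}.
Proof.
move=> /subspace_continuousP cH /subspace_continuousP cG.
apply/subspace_continuousP => p Ap.
have Ap' : (`[0, 1] `*` setT) (p.1, H p.1 p.2) by split => //; case: Ap.
apply: (@cvg_comp _ _ _ (fun q : R * T => (q.1, H q.1 q.2))
  (fun q : R * T => G q.1 q.2) _ _ _ _ (cG _ Ap')) => /=.
have cvg_level : (fun q : R * T => (q.1, H q.1 q.2)) @
    within (`[0, 1] `*` setT) (nbhs p) --> (p.1, H p.1 p.2).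
  apply: (@cvg_pair _ _ _ _ (nbhs p.1) (nbhs (H p.1 p.2))); last exact: cH.
  by apply: cvg_within_filter; exact: cvg_fst.
move=> S nS; apply: (@filterS _ (nbhs p)) (cvg_level _ nS) => q Sq Aq.
by apply: Sq => //; split => //; case: Aq.
Qed.

Lemma isotopic_to_id_id : isotopic_to_id R (@id T).
Proof.
have c : {within `[0, 1] `*` setT, continuous (fun p : R * T => p.2)}.
  by apply: continuous_subspaceT => p; exact: cvg_snd.
by exists (fun _ => id) => //; split=> //; exists (fun _ => id).
Qed.

Lemma isotopic_to_id_comp (h k : T -> T) :
  isotopic_to_id R h -> isotopic_to_id R k -> isotopic_to_id R (k \o h).
Proof.
move=> [H [H0 [G [cH cG HG]]] <-] [H' [H'0 [G' [cH' cG' HG']]] <-].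
exists (fun u => H' u \o H u) => //; split=> [x /=|].
  by rewrite H0 H'0.
exists (fun u => G u \o G' u); split.
- exact: (isotopy_comp_continuous cH cH').
- exact: (isotopy_comp_continuous cG' cG).
- move=> u u01; have [HK GK] := HG u u01; have [HK' GK'] := HG' u u01.
  by split; exact: can_comp.
Qed.

(** The reversed isotopy is made of the inverses of the levels, not of the
    levels in the opposite order; hence it also starts at the identity. *)
Lemma isotopic_to_id_inv (h : T -> T) : isotopic_to_id R h ->
  exists2 g : T -> T, isotopic_to_id R g & cancel h g.
Proof.
move=> [H [H0 [G [cH cG HG]]] <-]; exists (G 1); last first.
  by have [|] := HG 1; rewrite ?ler01 ?lexx.
exists G => //; split=> [x|].
  by have [|+ _] := HG 0; [rewrite lexx ler01|move=> /(_ x); rewrite H0].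
by exists H; split=> // u u01; have [] := HG u u01.
Qed.

End IsotopicToIdentity.

(** * Reparametrizations of the circle *)

Section Reparametrizations.
Variable R : realType.
Implicit Types r : R -> R.

Lemma reparam_id : reparam (@id R).
Proof. by split=> // t; exact: cvg_id. Qed.

Lemma reparam_comp r r' : reparam r -> reparam r' -> reparam (r \o r').
Proof.
move=> [cr ir pr] [cr' ir' pr']; split.
- by move=> t; apply: continuous_comp; [exact: cr'|exact: cr].
- by move=> s t /ir'/ir.
- by move=> t /=; rewrite pr' pr.
Qed.

Lemma reparam_natD r (n : nat) t : reparam r -> r (t + n%:R) = r t + n%:R.
Proof.
move=> [_ _ pr]; elim: n => [|n IHn]; first by rewrite !addr0.
by rewrite -natr1 !addrA pr IHn.
Qed.

Lemma reparam_surj r y : reparam r -> exists x, r x = y.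
Proof.
move=> pr; have [cr _ _] := pr.
(* Any integer [n >= |y - r 0|] works, as [r (- n) = r 0 - n]. *)
set n := (Num.trunc `|y - r 0|).+1.
have : `|y - r 0| <= n%:R by exact/ltW/truncnS_gt.
rewrite ler_norml => /andP[]; rewrite lerBrDl => yl; rewrite lerBlDl => yr.
have r_n : r (- n%:R) = r 0 - n%:R.
  by apply: (addIr n%:R); rewrite -reparam_natD// addNr subrK.
have r_p : r n%:R = r 0 + n%:R by rewrite -reparam_natD// add0r.
have [] := @IVT R r (- n%:R) n%:R y; last by move=> x _ <-; exists x.
- by rewrite ge0_cp.
- exact: continuous_subspaceT.
- by rewrite r_n r_p ge_min yl le_max yr orbT.
Qed.

Lemma reparam_inv r : reparam r ->
  exists g, [/\ reparam g, cancel r g & cancel g r].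
Proof.
move=> pr; have [cr ir p1] := pr.
have /choice[g gK] : forall y, exists x, r x = y.
  by move=> y; exact: reparam_surj.
have r_inj : injective r by apply: inc_inj; exact: le_mono.
have rK : cancel r g by move=> x; apply: r_inj; rewrite gK.
exists g; split=> //; split.
- move=> y; rewrite -[y]gK.
  apply: (nbhs_singleton (@near_can_continuous R r g (g y) _ _)).
    by near=> x; exact: rK.
  by near=> x; exact: cr.
- move=> s t st; rewrite ltNge; apply: contraTN st => gts.
  by rewrite -leNgt -[s]gK -[t]gK (le_mono ir).
- by move=> t; apply: r_inj; rewrite p1 !gK.
Unshelve. all: by end_near.
Qed.

End Reparametrizations.

(** * Planar isotopy and Reidemeister equivalence *)

Section ColorEquivalence.
Variables (R : realType) (X : finQuandle).
Implicit Types c : colored_diagram R X.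

Lemma planar_isotopic_refl c : planar_isotopic c c.
Proof.
by exists id, id; split=> //; [exact: isotopic_to_id_id|exact: reparam_id].
Qed.

Lemma planar_isotopic_sym c c' : planar_isotopic c c' -> planar_isotopic c' c.
Proof.
move=> [h [r [ih pr c'E uE colE]]].
have [k ik hK] := isotopic_to_id_inv ih.
have [g [pg rK gK]] := reparam_inv pr.
exists k, g; split=> // t.
- by rewrite c'E hK gK.
- by rewrite uE gK.
- by move=> x; rewrite colE gK.
Qed.

Lemma planar_isotopic_trans c1 c2 c3 :
  planar_isotopic c1 c2 -> planar_isotopic c2 c3 -> planar_isotopic c1 c3.
Proof.
move=> [h [r [ih pr cE uE colE]]] [h' [r' [ih' pr' cE' uE' colE']]].
exists (h' \o h), (r \o r'); split.
- exact: isotopic_to_id_comp.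
- exact: reparam_comp.
- by move=> t; rewrite cE' cE.
- by move=> t; rewrite uE' uE.
- by move=> t x; rewrite colE' colE.
Qed.

(** A sequence of moves always begins with a planar isotopy, possibly the
    identity, which absorbs any isotopy put in front of it. *)
Lemma color_equiv_isotopic_trans c1 c2 c3 :
  planar_isotopic c1 c2 -> color_equiv c2 c3 -> color_equiv c1 c3.
Proof.
move=> i12 e23; case: e23 i12 => [c c' icc'|c d d' c' icd mdd' ed'c'] i12.
  by apply: color_equiv_nil; exact: planar_isotopic_trans icc'.
by apply: color_equiv_cons mdd' ed'c'; exact: planar_isotopic_trans icd.
Qed.

Lemma color_equiv_trans c1 c2 c3 :
  color_equiv c1 c2 -> color_equiv c2 c3 -> color_equiv c1 c3.
Proof.
move=> e12; elim: e12 c3 => [c c' icc'|c d d' c' icd mdd' _ IH] c3 e.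
  exact: color_equiv_isotopic_trans e.
exact: color_equiv_cons icd mdd' (IH _ e).
Qed.

Lemma color_equiv_sym c c' : color_equiv c c' -> color_equiv c' c.
Proof.
elim=> {c c'} [c c' icc'|c d d' c' icd mdd' _ IH].
  by apply: color_equiv_nil; exact: planar_isotopic_sym.
apply: color_equiv_trans IH _.
apply: color_equiv_cons (planar_isotopic_refl d') _ (color_equiv_nil _).
  by case: mdd' => m; [right; exact: m|left; exact: m].
exact: planar_isotopic_sym.
Qed.

End ColorEquivalence.

Theorem mainTheorem2 (R : realType) (X : finQuandle) (K : knot R) :
  RelationClasses.Equivalence (@coloring_equiv R X K).
Proof.
split.
- by move=> C; exact: color_equiv_nil (planar_isotopic_refl _).
- by move=> C C' /color_equiv_sym.
- by move=> C1 C2 C3; exact: color_equiv_trans.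
Qed.
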